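(* Let $a<b$, $m>0$, $V\in C^1(\mathbb{R})$, and let $\xi_*\in C^2([a,b])$ satisfy $$m\cosh(\dot\xi_*(t))\,\ddot\xi_*(t)+V'(\xi_*(t))=0\quad\text{on }[a,b].$$ Then the first variation of $\mathcal{L}_V$ at $\xi_*$ vanishes on every $C^1$ endpoint-fixed variation: for every $\eta\in C^1([a,b])$ with $\eta(a)=\eta(b)=0$, $\left.\frac{d}{d\varepsilon}\right|_{\varepsilon=0}\mathcal{L}_V[\xi_*+\varepsilon\eta]=0$.
   Context: For a $C^1$ curve $\xi:[a,b]\to\mathbb{R}$, $\mathcal{L}_V[\xi]:=\int_a^b\bigl[m(\cosh(\dot\xi(t))-1)-V(\xi(t))\bigr]\,dt$. *)

(* Defs.v *)
From Stdlib Require Import Reals.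
From Coquelicot Require Import Coquelicot.
Local Open Scope R_scope.

(* A function on [a,b] is represented by a total function R -> R whose values
   outside [a,b] are irrelevant: the derivative below is taken within [a,b],
   hence is the one-sided derivative at the endpoints. *)

Definition Icc (a b t : R) : Prop := a <= t <= b.

Definition is_derive_on (a b : R) (f : R -> R) (t l : R) : Prop :=
  filterlim (fun s => (f s - f t) / (s - t))
    (within (Icc a b) (locally' t)) (locally l).

Definition ex_derive_on (a b : R) (f : R -> R) (t : R) : Prop :=
  exists l : R, is_derive_on a b f t l.

(* For a < b and t in [a,b] the limit is unique, so this is its value as soon
   as ex_derive_on holds. *)
Definition Derive_on (a b : R) (f : R -> R) (t : R) : R :=
  iota (is_derive_on a b f t).

Definition C1_on (a b : R) (f : R -> R) : Prop :=
  (forall t, a <= t <= b -> ex_derive_on a b f t) /\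
  continuous_on (Icc a b) (Derive_on a b f).

Definition C2_on (a b : R) (f : R -> R) : Prop :=
  C1_on a b f /\ C1_on a b (Derive_on a b f).

Definition C1_R (V : R -> R) : Prop :=
  (forall x, ex_derive V x) /\ (forall x, continuous (Derive V) x).

Definition Lagr (m : R) (V : R -> R) (a b : R) (xi : R -> R) : R :=
  RInt (fun t => m * (cosh (Derive_on a b xi t) - 1) - V (xi t)) a b.

(* Main.v *)
(** Replacing [xi], [xi'] and [eta] by C^1 extensions to the whole line, one may
    differentiate under the integral sign, and the first variation is
    [RInt (fun t => m * sinh (xi' t) * eta' t - V' (xi t) * eta t) a b].  By the
    Euler-Lagrange equation the integrand is the derivative of
    [m * sinh xi' * eta], which vanishes at both endpoints. *)

Require Import Defs.
From Stdlib Require Import Reals Lra.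
From Coquelicot Require Import Coquelicot.
Local Open Scope R_scope.

(** * Derivatives within a compact interval *)

Lemma within_Icc_locally'_proper (a b t : R) :
  a < b -> a <= t <= b -> ProperFilter' (within (Icc a b) (locally' t)).
Proof.
intros ab [at_ tb]; constructor; [|apply within_filter, within_filter, locally_filter].
intros [d Hd].
assert (d0 := cond_pos d).
assert (H : forall s, Rabs (s - t) < d -> s <> t -> Icc a b s -> False)
  by (intros s Hs; exact (Hd s Hs)).
(* Some side of [t] has room inside [[a,b]]: step right if [t < b], and otherwise [t = b] and step
   left, by at most [d / 2] and never past the far endpoint. *)
destruct (Rlt_le_dec t b) as [tb'|bt].
- assert (M := Rmin_l (d / 2) (b - t)). assert (M' := Rmin_r (d / 2) (b - t)).
  assert (P : 0 < Rmin (d / 2) (b - t)) by (apply Rmin_glb_lt; lra).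
  apply (H (t + Rmin (d / 2) (b - t))); [|lra|split; lra].
  rewrite Rabs_pos_eq; lra.
- assert (M := Rmin_l (d / 2) (t - a)). assert (M' := Rmin_r (d / 2) (t - a)).
  assert (P : 0 < Rmin (d / 2) (t - a)) by (apply Rmin_glb_lt; lra).
  apply (H (t - Rmin (d / 2) (t - a))); [|lra|split; lra].
  rewrite Rabs_left; lra.
Qed.

(** Properness of the punctured filter makes the limit unique, so [iota] has to pick it. *)
Lemma Derive_on_unique (a b : R) (f : R -> R) (t l : R) :
  a < b -> a <= t <= b -> is_derive_on a b f t l -> Derive_on a b f t = l.
Proof.
intros ab Ht Hl.
exact (@iota_filterlim_locally _ R_CompleteNormedModule _ _
  (within_Icc_locally'_proper a b t ab Ht)
  (fun s => (f s - f t) / (s - t)) l Hl).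
Qed.

Lemma Derive_on_correct (a b : R) (f : R -> R) (t : R) :
  a < b -> a <= t <= b -> ex_derive_on a b f t ->
  is_derive_on a b f t (Derive_on a b f t).
Proof.
intros ab Ht [l Hl]; now rewrite (Derive_on_unique a b f t l).
Qed.

Lemma is_derive_on_plus_scal (a b : R) (f g : R -> R) (t k l c : R) :
  is_derive_on a b f t k -> is_derive_on a b g t l ->
  is_derive_on a b (fun s => f s + c * g s) t (k + c * l).
Proof.
intros Hf Hg; unfold is_derive_on.
apply filterlim_ext with
  (fun s => plus ((f s - f t) / (s - t)) (scal c ((g s - g t) / (s - t)))).
{ intros s; unfold plus, scal; simpl; unfold mult; simpl; unfold Rdiv; ring. }
eapply filterlim_comp_2; [exact Hf| |exact (filterlim_plus k (scal c l))].
eapply filterlim_comp; [exact Hg|exact (filterlim_scal_r c l)].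
Qed.

Lemma is_derive_on_epsilon (a b : R) (f : R -> R) (t l : R) :
  is_derive_on a b f t l -> forall e, 0 < e ->
  exists d : posreal, forall s, Rabs (s - t) < d -> s <> t -> a <= s <= b ->
  Rabs ((f s - f t) / (s - t) - l) < e.
Proof.
intros H e He.
destruct (proj1 (filterlim_locally _ _) H (mkposreal e He)) as [d Hd].
exists d; exact Hd.
Qed.

Lemma is_derive_on_interior (a b : R) (f : R -> R) (t l : R) :
  a < t < b -> is_derive_on a b f t l -> is_derive f t l.
Proof.
intros Ht H; apply is_derive_Reals; intros e He.
destruct (is_derive_on_epsilon _ _ _ _ _ H e He) as [d Hd].
(* Below this radius [t + h] stays in [[a,b]], so the restriction to the interval is no constraint
   on increments. *)
assert (P : 0 < Rmin d (Rmin (t - a) (b - t)))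
  by (repeat apply Rmin_glb_lt; try lra; apply cond_pos).
exists (mkposreal _ P); simpl; intros h h0 Hh.
assert (h1 := Rlt_le_trans _ _ _ Hh (Rmin_l _ _)).
assert (h2 := Rlt_le_trans _ _ _ Hh (Rmin_r _ _)).
assert (h3 := Rlt_le_trans _ _ _ h2 (Rmin_l _ _)).
assert (h4 := Rlt_le_trans _ _ _ h2 (Rmin_r _ _)).
apply Rabs_def2 in h3; apply Rabs_def2 in h4.
replace h with (t + h - t) at 2 by ring.
apply Hd; [now replace (t + h - t) with h by ring|lra|lra].
Qed.

(** Near [t] the difference quotients are bounded by [Rabs l + 1], so [f s - f t] is at most this
    bound times [Rabs (s - t)]; the radius is chosen accordingly. *)
Lemma is_derive_on_continuous (a b : R) (f : R -> R) (t l : R) :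
  is_derive_on a b f t l ->
  filterlim f (within (Icc a b) (locally t)) (locally (f t)).
Proof.
intros H; apply filterlim_locally; intros e.
destruct (is_derive_on_epsilon _ _ _ _ _ H 1 Rlt_0_1) as [d Hd].
assert (L : 0 < Rabs l + 1) by (generalize (Rabs_pos l); lra).
assert (P : 0 < Rmin d (e / (Rabs l + 1))).
{ apply Rmin_glb_lt; [apply cond_pos|apply Rdiv_lt_0_compat; [apply cond_pos|exact L]]. }
exists (mkposreal _ P); intros s Hs Is.
change (Rabs (s - t) < Rmin d (e / (Rabs l + 1))) in Hs.
change (Rabs (f s - f t) < e).
assert (h1 := Rlt_le_trans _ _ _ Hs (Rmin_l _ _)).
assert (h2 := Rlt_le_trans _ _ _ Hs (Rmin_r _ _)).
destruct (Req_dec s t) as [->|st].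
{ rewrite Rminus_diag, Rabs_R0; apply cond_pos. }
specialize (Hd s h1 st Is).
replace (f s - f t) with ((f s - f t) / (s - t) * (s - t)) by (field; lra).
rewrite Rabs_mult.
assert (Q : Rabs ((f s - f t) / (s - t)) <= Rabs l + 1).
{ generalize (Rabs_triang_inv ((f s - f t) / (s - t)) l); lra. }
apply Rle_lt_trans with ((Rabs l + 1) * Rabs (s - t)).
{ apply Rmult_le_compat_r; [apply Rabs_pos|exact Q]. }
replace (pos e) with ((Rabs l + 1) * (e / (Rabs l + 1))) by (field; lra).
now apply Rmult_lt_compat_l.
Qed.

(** * Extension of [C^1] functions from [[a,b]] to the line *)

Definition clamp (a b t : R) : R := Rmax a (Rmin b t).

Lemma clamp_bounds (a b t : R) : a <= b -> a <= clamp a b t <= b.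
Proof.
unfold clamp, Rmax, Rmin; repeat destruct Rle_dec; lra.
Qed.

Lemma clamp_id (a b t : R) : a <= t <= b -> clamp a b t = t.
Proof.
unfold clamp, Rmax, Rmin; repeat destruct Rle_dec; lra.
Qed.

Lemma clamp_contract (a b s t : R) :
  a <= b -> Rabs (clamp a b s - clamp a b t) <= Rabs (s - t).
Proof.
unfold clamp, Rmax, Rmin, Rabs; repeat destruct Rle_dec;
  repeat destruct Rcase_abs; lra.
Qed.

(** [clamp] is 1-Lipschitz with values in [[a,b]], so it carries full neighbourhoods into relative
    ones. *)
Lemma continuous_clamp (a b : R) (f : R -> R) :
  a <= b -> continuous_on (Icc a b) f ->
  forall t, continuous (fun s => f (clamp a b s)) t.
Proof.
intros ab Hf t; unfold continuous.
apply filterlim_comp with (within (Icc a b) (locally (clamp a b t)));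
  [|apply Hf; now apply clamp_bounds].
intros P [d Hd]; exists d; intros s Hs.
apply Hd; [|now apply clamp_bounds].
exact (Rle_lt_trans _ _ _ (clamp_contract a b s t ab) Hs).
Qed.

(** [F'] prolongs the derivative of [f] by its endpoint values, and [F] is the primitive of [F']
    with [F a = f a]. On [[a,b]] the difference of [f] and [F] has zero derivative in the interior
    and vanishes at [a], so the mean value theorem makes it zero. *)
Lemma C1_on_extension (a b : R) (f : R -> R) :
  a < b -> C1_on a b f -> exists F F' : R -> R,
  (forall t, is_derive F t (F' t)) /\ (forall t, continuous F' t) /\
  forall t, a <= t <= b -> F t = f t /\ F' t = Derive_on a b f t.
Proof.
intros ab [Ef Cf].
set (F' := fun t => Derive_on a b f (clamp a b t)).
set (F := fun t => f a + RInt F' a t).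
assert (CF' : forall t, continuous F' t) by (apply continuous_clamp; [lra|exact Cf]).
assert (DF : forall t, is_derive F t (F' t)).
{ intros t; unfold F.
  rewrite <- (Rplus_0_l (F' t)).
  apply @is_derive_plus; [apply @is_derive_const|].
  apply is_derive_RInt with a; [|apply CF'].
  apply filter_forall; intros x.
  apply (@RInt_correct R_CompleteNormedModule).
  apply (@ex_RInt_continuous R_CompleteNormedModule); intros; apply CF'. }
exists F, F'; split; [exact DF|split; [exact CF'|]].
intros t Ht; split; [|unfold F'; now rewrite clamp_id].
(* The values of [f] outside [[a,b]] are arbitrary; clamping makes [G] continuous from both sides at
   the endpoints too. *)
set (G := fun s => f (clamp a b s) - F s).
assert (FC : forall s, continuous F s)
  by (intros s; apply (@ex_derive_continuous R_AbsRing R_NormedModule);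
      eexists; apply DF).
destruct (MVT_gen G a t (fun _ => 0)) as [c [_ Hc]].
- rewrite Rmin_left, Rmax_right by lra; intros x Hx.
  replace 0 with (F' x - F' x) by ring.
  apply @is_derive_minus; [|apply DF].
  apply is_derive_ext_loc with f.
  + assert (P : 0 < Rmin (x - a) (b - x)) by (apply Rmin_glb_lt; lra).
    exists (mkposreal _ P); intros s Hs; symmetry; f_equal; apply clamp_id.
    change (Rabs (s - x) < Rmin (x - a) (b - x)) in Hs.
    assert (h1 := Rlt_le_trans _ _ _ Hs (Rmin_l _ _)).
    assert (h2 := Rlt_le_trans _ _ _ Hs (Rmin_r _ _)).
    apply Rabs_def2 in h1; apply Rabs_def2 in h2; lra.
  + apply is_derive_on_interior with a b; [lra|].
    unfold F'; rewrite clamp_id by lra.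
    apply Derive_on_correct; [lra|lra|apply Ef; lra].
- intros x _; apply continuity_pt_filterlim.
  apply @continuous_minus; [|apply FC].
  apply continuous_clamp; [lra|]; intros s Hs.
  destruct (Ef s Hs) as [l Hl].
  now apply is_derive_on_continuous with l.
- unfold G in Hc; rewrite !clamp_id in Hc by lra.
  assert (Fa : F a = f a).
  { unfold F; rewrite RInt_point; unfold zero; simpl; ring. }
  lra.
Qed.

(** * Differentiation of the action under the integral sign *)

Lemma is_derive_cosh (x : R) : is_derive cosh x (sinh x).
Proof.
apply is_derive_Reals, derivable_pt_lim_cosh.
Qed.

Lemma is_derive_sinh (x : R) : is_derive sinh x (cosh x).
Proof.
apply is_derive_Reals, derivable_pt_lim_sinh.
Qed.

Lemma continuity_2d_pt_line (f g : R -> R) (u t : R) :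
  continuous f t -> continuous g t ->
  continuity_2d_pt (fun e s => f s + e * g s) u t.
Proof.
intros Hf Hg.
apply continuity_2d_pt_plus;
  [|apply continuity_2d_pt_mult; [apply continuity_2d_pt_id1|]];
  (apply continuity_1d_2d_pt_comp; [|apply continuity_2d_pt_id2]);
  now apply continuity_pt_filterlim.
Qed.

Section FirstVariation.

Variables (m a b : R) (V X X' Y Y' : R -> R).
Hypothesis HV : C1_R V.
Hypothesis CX : forall t, continuous X t.
Hypothesis CX' : forall t, continuous X' t.
Hypothesis CY : forall t, continuous Y t.
Hypothesis CY' : forall t, continuous Y' t.

Let L (e t : R) : R := m * (cosh (X' t + e * Y' t) - 1) - V (X t + e * Y t).
Let dL (e t : R) : R :=
  m * (sinh (X' t + e * Y' t) * Y' t) - Derive V (X t + e * Y t) * Y t.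

Let is_derive_L (e t : R) : is_derive (fun u => L u t) e (dL e t).
Proof.
unfold L, dL; auto_derive.
- repeat split; apply (proj1 HV).
- change (fun x => V x) with V; ring.
Qed.

Let continuity_dL (e t : R) : continuity_2d_pt dL e t.
Proof.
assert (CV := proj2 HV).
unfold dL; apply continuity_2d_pt_minus; apply continuity_2d_pt_mult;
  [|apply continuity_2d_pt_mult| |].
- apply continuity_2d_pt_const.
- apply continuity_1d_2d_pt_comp; [|now apply continuity_2d_pt_line].
  apply derivable_continuous_pt; eexists; apply derivable_pt_lim_sinh.
- apply continuity_1d_2d_pt_comp; [|apply continuity_2d_pt_id2].
  apply continuity_pt_filterlim, CY'.
- apply continuity_1d_2d_pt_comp; [|now apply continuity_2d_pt_line].
  apply continuity_pt_filterlim, CV.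
- apply continuity_1d_2d_pt_comp; [|apply continuity_2d_pt_id2].
  apply continuity_pt_filterlim, CY.
Qed.

Let continuous_L (e t : R) : continuous (L e) t.
Proof.
assert (C : forall f g : R -> R, (forall s, continuous f s) ->
  (forall s, continuous g s) -> continuous (fun s => f s + e * g s) t).
{ intros f g Hf Hg; apply @continuous_plus; [apply Hf|].
  apply (@continuous_scal_r _ R_AbsRing R_NormedModule e g), Hg. }
unfold L; apply @continuous_minus.
- apply (@continuous_scal_r _ R_AbsRing R_NormedModule m).
  apply @continuous_minus; [|apply continuous_const].
  apply continuous_comp; [now apply C|].
  apply (@ex_derive_continuous R_AbsRing R_NormedModule); eexists; apply is_derive_cosh.
- apply continuous_comp; [now apply C|].
  apply (@ex_derive_continuous R_AbsRing R_NormedModule), (proj1 HV).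
Qed.

(** Leibniz rule: [L] is differentiable in [e], its derivative [dL] is jointly continuous in
    [(e, t)], and each [L e] is integrable. Positions [X], [Y] and velocities [X'], [Y'] enter as
    separate continuous functions, since only [e] is differentiated. *)
Lemma first_variation :
  is_derive
    (fun e => RInt
      (fun t => m * (cosh (X' t + e * Y' t) - 1) - V (X t + e * Y t)) a b) 0
    (RInt (fun t => m * (sinh (X' t) * Y' t) - Derive V (X t) * Y t) a b).
Proof.
assert (D : forall e t, Derive (fun u => L u t) e = dL e t)
  by (intros; apply is_derive_unique, is_derive_L).
replace (RInt _ a b) with (RInt (fun t => Derive (fun u => L u t) 0) a b).
- apply (is_derive_RInt_param L).
  + apply filter_forall; intros e t _; eexists; apply is_derive_L.
  + intros t _; apply continuity_2d_pt_ext with dL; [|apply continuity_dL].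
    intros; symmetry; apply D.
  + apply filter_forall; intros e.
    apply (@ex_RInt_continuous R_CompleteNormedModule); intros; apply continuous_L.
- apply RInt_ext; intros t _; rewrite D; unfold dL.
  now rewrite !Rmult_0_l, !Rplus_0_r.
Qed.

End FirstVariation.

(** * Vanishing of the first variation *)

Theorem theorem8p4 (a b m : R) (V xi : R -> R) :
  a < b -> 0 < m -> C1_R V -> C2_on a b xi ->
  (forall t, a <= t <= b ->
    m * cosh (Derive_on a b xi t) * Derive_on a b (Derive_on a b xi) t
      + Derive V (xi t) = 0) ->
  forall eta : R -> R, C1_on a b eta -> eta a = 0 -> eta b = 0 ->
  is_derive (fun eps => Lagr m V a b (fun t => xi t + eps * eta t)) 0 0.
Proof.
intros ab _ HV [Hxi Hxi'] EL eta Heta eta_a eta_b.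
destruct (C1_on_extension a b xi ab Hxi) as (X & X0 & DX & _ & EX).
(* The velocity is represented by [P], a [C^1] extension of the derivative of [xi], and not by [X0],
   which is merely continuous: [sinh (P t)] has to be differentiated below. *)
destruct (C1_on_extension a b _ ab Hxi') as (P & P' & DP & CP' & EP).
destruct (C1_on_extension a b eta ab Heta) as (Y & Y' & DY & CY' & EY).
assert (C : forall F F' : R -> R, (forall t, is_derive F t (F' t)) ->
  forall t, continuous F t).
{ intros F F' H t; apply (@ex_derive_continuous R_AbsRing R_NormedModule).
  eexists; apply H. }
assert (FV := first_variation m a b V X P Y Y' HV (C _ _ DX) (C _ _ DP) (C _ _ DY) CY').
assert (Z : RInt (fun t => m * (sinh (P t) * Y' t) - Derive V (X t) * Y t) a b = 0).
{ assert (E : forall t, Rmin a b < t < Rmax a b ->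
    m * (sinh (P t) * Y' t) - Derive V (X t) * Y t =
    m * (cosh (P t) * P' t * Y t + sinh (P t) * Y' t)).
  { rewrite Rmin_left, Rmax_right by lra; intros t Ht.
    assert (It : a <= t <= b) by lra.
    generalize (EL t It).
    destruct (EX t It) as [<- _], (EP t It) as [<- <-]; intros E.
    (* [E] is now the Euler-Lagrange equation in terms of [X], [P] and [P']. *)
    replace (Derive V (X t)) with (- (m * cosh (P t) * P' t)) by lra; ring. }
  rewrite (RInt_ext _ _ _ _ E).
  (* Zero is written as the boundary term of the primitive [m * (sinh (P t) * Y t)]; both parts
     vanish because [Y] agrees with [eta] at [a] and [b]. *)
  replace 0 with (minus (m * (sinh (P b) * Y b)) (m * (sinh (P a) * Y a))).
  - apply is_RInt_unique.
    apply (is_RInt_derive (fun t => m * (sinh (P t) * Y t))).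
    * intros t _.
      apply @is_derive_scal.
      apply (is_derive_mult (fun t => sinh (P t)) Y);
        [|apply DY|intros; apply Rmult_comm].
      rewrite Rmult_comm.
      apply (is_derive_comp sinh P); [apply is_derive_sinh|apply DP].
    * intros t _.
      apply (@continuous_scal_r _ R_AbsRing R_NormedModule m).
      apply @continuous_plus; apply @continuous_mult; [| |apply continuous_comp|].
      -- apply @continuous_mult; [apply continuous_comp|apply CP'].
         ++ apply (C _ _ DP).
         ++ apply (C _ _ is_derive_cosh).
      -- apply (C _ _ DY).
      -- apply (C _ _ DP).
      -- apply (C _ _ is_derive_sinh).
      -- apply CY'.
  - destruct (EY a) as [-> _]; [lra|]; destruct (EY b) as [-> _]; [lra|].
    rewrite eta_a, eta_b; unfold minus, plus, opp; simpl; ring. }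
rewrite Z in FV.
refine (is_derive_ext _ _ _ _ _ FV).
intros e; unfold Lagr; apply RInt_ext.
rewrite Rmin_left, Rmax_right by lra; intros t Ht.
assert (It : a <= t <= b) by lra.
(* Linearity of the derivative within [[a,b]] identifies the velocity of the varied curve, so for
   every [e] the action of the extended data equals [Lagr]. *)
rewrite (Derive_on_unique a b (fun t => xi t + e * eta t) t
  (Derive_on a b xi t + e * Derive_on a b eta t)); [|lra|lra|].
- destruct (EX t It) as [-> _], (EP t It) as [-> _], (EY t It) as [-> ->].
  reflexivity.
- apply is_derive_on_plus_scal; apply Derive_on_correct; trivial.
  + now apply (proj1 Hxi).
  + now apply (proj1 Heta).
Qed.
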